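(* Let $\mathcal{U}=\{u_1,\ldots,u_M\}\subset\mathbb{R}\setminus\{0\}$ be a fixed finite set of $M\ge 1$ distinct nonzero reals, $u_{\min}=\min_{m}|u_m|$, and let $\sigma^2>0$ be fixed. For integers $N>k\ge 1$, let $x$ be uniformly distributed on $\mathcal{X}_k^N(\mathcal{U})$ and $y=x+\omega$ with $\omega\sim\mathcal{N}(0,\sigma_{N/k}^2 I_N)$ independent of $x$, where $\sigma_{N/k}^2=\sigma^2/\log(N/k)$. Let $\hat{x}_{\mathrm{ML}}\in\mathcal{X}_k^N(\mathcal{U})$ be the maximum likelihood estimator of $x$ based on $y$, i.e. $\hat{x}_{\mathrm{ML}}\in\operatorname{argmax}_{x'\in\mathcal{X}_k^N(\mathcal{U})}p(y\mid x')$. If $\sigma^2<u_{\min}^2/2$, then $k^{-1}\mathbb{E}[\|x-\hat{x}_{\mathrm{ML}}\|_2^2]\to 0$ as $k,N\to\infty$ with $\log k/\log N\to\gamma$ for some $\gamma\in[0,1)$.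
   Context: For $v\in\mathbb{R}^N$, $\mathcal{S}_v=\{n\in\{1,\ldots,N\}: v_n\neq 0\}$ is its support. $\mathcal{X}_k^N(\mathcal{U})$ denotes the set of vectors $x\in\mathbb{R}^N$ with $|\mathcal{S}_x|=k$ and $x_n\in\mathcal{U}$ for all $n\in\mathcal{S}_x$. Here $p(y\mid x')$ is the Gaussian density $(2\pi\sigma_{N/k}^2)^{-N/2}\exp(-\|y-x'\|_2^2/(2\sigma_{N/k}^2))$. The expectation is over $x$ and $\omega$. *)

(* Defs.v *)
From HB Require Import structures.
From mathcomp Require Import all_boot all_order all_algebra.
From mathcomp Require Import all_classical all_reals all_analysis.
From mathcomp Require Import normal_distribution.

Set Implicit Arguments.
Unset Strict Implicit.
Unset Printing Implicit Defensive.

Import Order.TTheory GRing.Theory Num.Theory.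
Local Open Scope classical_set_scope.
Local Open Scope ring_scope.

Section defs.
Variable R : realType.

Definition sqdist (N : nat) (a b : N.-tuple R) : R :=
  \sum_(i < N) (tnth a i - tnth b i) ^+ 2.

Definition support (N : nat) (v : N.-tuple R) : {set 'I_N} :=
  [set i | tnth v i != 0].

Definition Xset (M : nat) (u : 'I_M -> R) (N k : nat) : set (N.-tuple R) :=
  [set x | #|support x| = k /\ forall i, i \in support x -> exists m, tnth x i = u m].


Definition umin (M : nat) (u : 'I_M.+1 -> R) : R :=
  \big[Num.min/`|u ord0|]_(m < M.+1) `|u m|.

Definition sigmaNk (sigma2 : R) (N k : nat) : R :=
  sigma2 / ln (N%:R / k%:R).

Definition lik (N : nat) (s2 : R) (y x' : N.-tuple R) : R :=
  powR (2 * pi * s2) (- (N%:R / 2)) * expR (- sqdist y x' / (2 * s2)).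


(* Expectation of a nonnegative function of omega ~ N(0, s^2 I_N), written as
   the iterated integral against the product of N one-dimensional normal laws
   with standard deviation s. *)
Fixpoint gauss_expect (s : R) (N : nat) : (N.-tuple R -> \bar R) -> \bar R :=
  match N return (N.-tuple R -> \bar R) -> \bar R with
  | 0 => fun f => f [tuple]
  | N'.+1 => fun f =>
      (\int[normal_prob 0 s]_(w in [set: R])
         gauss_expect s (fun t : N'.-tuple R => f [tuple of w :: t]))%E
  end.


Definition tadd (N : nat) (a b : N.-tuple R) : N.-tuple R :=
  [tuple tnth a i + tnth b i | i < N].

Definition is_ML (M : nat) (u : 'I_M -> R) (N k : nat) (s2 : R)
    (est : N.-tuple R -> N.-tuple R) : Prop :=
  forall y, @Xset M u N k (est y) /\
    forall x', @Xset M u N k x' -> lik s2 y x' <= lik s2 y (est y).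

End defs.
Arguments Xset {R M} u N k x.
Arguments lik {R N} s2 y x'.
Arguments gauss_expect {R} s N f.
Arguments is_ML {R M} u N k s2 est.

(* Main.v *)
(* Let y = x + w and let v be the maximum likelihood estimate. As v is nearest to
   y, exchanging a false alarm j of v for a missed position i of x does not bring
   v closer to y, which forces |w_i| >= d or |w_j| >= t, for any d, t with
   t^2 <= u_min^2 - 2 d u_min and d small. There are as many false alarms as missed
   positions, so the number of wrong coordinates is at most three times
   #{i in S_x : |w_i| >= d} + #{i notin S_x : |w_i| >= t}. Since sigma^2 < u_min^2 / 2
   one may take t^2 > 2 sigma^2. With L = log(N/k) -> oo, Gaussian tails then bound
   the expectation of this count by k e^(-aL) + N e^(-bL) up to a constant, with
   a > 0 and b > 1; and N e^(-bL) = k e^(-(b-1)L), so it is o(k). *)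
Require Import Defs.
From HB Require Import structures.
From mathcomp Require Import all_boot all_order all_algebra.
From mathcomp Require Import all_classical all_reals all_analysis.
From mathcomp Require Import normal_distribution measurable_realfun.
From mathcomp Require Import ring lra.
Import Order.TTheory GRing.Theory Num.Theory.
Import numFieldNormedType.Exports.
Local Open Scope classical_set_scope.
Local Open Scope ring_scope.

Set Implicit Arguments.
Unset Strict Implicit.
Unset Printing Implicit Defensive.

Local Notation supp := Defs.support.

(** * Single-coordinate changes and the competitors of the estimate *)

Definition update (R : realType) (N : nat) (v : N.-tuple R) (i : 'I_N) (a : R) :
    N.-tuple R :=
  [tuple if l == i then a else tnth v l | l < N].

Lemma tnth_update (R : realType) (N : nat) (v : N.-tuple R) i a l :
  tnth (update v i a) l = if l == i then a else tnth v l.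
Proof. by rewrite tnth_mktuple. Qed.

Lemma sqdist_update (R : realType) (N : nat) (y v : N.-tuple R) i a :
  sqdist y (update v i a) =
  sqdist y v - (tnth y i - tnth v i) ^+ 2 + (tnth y i - a) ^+ 2.
Proof.
rewrite /sqdist (bigD1 i)//= [in RHS](bigD1 i)//= tnth_update eqxx.
rewrite [X in _ + X](eq_bigr (fun l => (tnth y l - tnth v l) ^+ 2)); last first.
  by move=> l /negPf li; rewrite tnth_update li.
by ring.
Qed.

Lemma Xset_correct (R : realType) (M N k : nat) (u : 'I_M -> R)
    (x v : N.-tuple R) i :
  Xset u N k x -> Xset u N k v -> tnth x i != 0 -> tnth v i != 0 ->
  Xset u N k (update v i (tnth x i)).
Proof.
move=> [_ xu] [vk vu] xi vi.
have sE : supp (update v i (tnth x i)) = supp v.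
  apply/setP => l; rewrite !inE tnth_update.
  by have [->|] := eqVneq l i; rewrite ?xi ?vi.
split; rewrite sE // => l lv; rewrite tnth_update.
by have [_|_] := eqVneq l i; [apply: xu; rewrite inE|apply: vu].
Qed.

(** The competitor for the exchange argument: the support loses [j] and gains [i], which was not in
    it, so its size stays [k]. *)
Lemma Xset_swap (R : realType) (M N k : nat) (u : 'I_M -> R)
    (x v : N.-tuple R) i j :
  Xset u N k x -> Xset u N k v ->
  i \in supp x :\: supp v -> j \in supp v ->
  Xset u N k (update (update v j 0) i (tnth x i)).
Proof.
move=> [_ xu] [vk vu]; rewrite finset.in_setD => /andP[iv ix] jv.
have xi : tnth x i != 0 by move: ix; rewrite inE.
have sE : supp (update (update v j 0) i (tnth x i)) =
    i |: (supp v :\ j).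
  apply/setP => l; rewrite !inE !tnth_update.
  by have [->|_] //= := eqVneq l i; have [->|] := eqVneq l j; rewrite ?eqxx.
split; rewrite sE.
  rewrite cardsU1 finset.in_setD1 (negPf iv) andbF.
  by move: (cardsD1 j (supp v)); rewrite jv vk => ->.
move=> l; rewrite finset.in_setU1 finset.in_setD1 !tnth_update.
have [->|_] /= := eqVneq l i; first by move=> _; exact: xu.
by move=> /andP[/negPf -> lv]; apply: vu.
Qed.

(** * Deterministic error bound by the number of bad coordinates *)

Definition bad_noise (R : realType) (d t a : R) : set R :=
  [set r | (if a != 0 then d else t) <= `|r|].

Lemma bad_noiseE (R : realType) (d t a r : R) :
  (r \in bad_noise d t a) = ((if a != 0 then d else t) <= `|r|).
Proof. by apply/idP/idP => [/set_mem|/mem_set]. Qed.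

Section ML_error.
Variables (R : realType) (M N k : nat) (u : 'I_M.+1 -> R).
Variables (x v w : N.-tuple R) (d t D : R).
Hypotheses (u_neq0 : forall m, u m != 0).
Hypotheses (xX : Xset u N k x) (vX : Xset u N k v).
Hypotheses (v_opt : forall v', Xset u N k v' ->
  sqdist (tadd x w) v <= sqdist (tadd x w) v').
Hypotheses (d_sep : forall m m', u m != u m' -> d *+ 2 <= `|u m - u m'|).
Hypothesis (t_sep : forall m, t ^+ 2 <= u m ^+ 2 - d *+ 2 * `|u m|).
Hypotheses (D_ge : forall m, u m ^+ 2 <= D)
  (D_geB : forall m m', (u m - u m') ^+ 2 <= D).

Let bad : {set 'I_N} := [set i | tnth w i \in bad_noise d t (tnth x i)]%SET.

(** Write [a = x_i], [r = w_i], [s = w_j], [b = v_j]. Optimality against the swap reads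
    [a^2 + 2 a r + (s - b)^2 <= s^2]. If [|r| < d] and [|s| < t], then [a^2 - 2 d |a| < s^2 < t^2],
    against [t_sep]. *)
Lemma ML_swap_bad i j :
  i \in supp x :\: supp v -> j \in supp v :\: supp x ->
  (i \in bad) || (j \in bad).
Proof.
move=> isD jsD; move: (isD) (jsD); rewrite !inE !negbK.
move=> /andP[/eqP/= vi0 xi0] /andP[/eqP xj0 vj0].
have ij : i != j by apply: contraNneq xi0 => ->; rewrite xj0.
have jv : j \in supp v by rewrite inE.
have := v_opt (Xset_swap xX vX isD jv).
rewrite !sqdist_update !tnth_update (negPf ij) vi0 !tnth_mktuple xj0.
have [m xim] : exists m, tnth x i = u m by apply: xX.2; rewrite inE.
rewrite !bad_noiseE xi0 /= eqxx /=.
have := t_sep m; have := u_neq0 m; rewrite -xim => um0 tm opt.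
apply/negPn/negP; rewrite negb_or => /andP[]; rewrite -!ltNge.
move: (tnth x i) (tnth w i) (tnth w j) (tnth v j) um0 tm opt => a r s b.
move=> a0 tm opt rd st.
have a_gt0 : 0 < `|a| by rewrite normr_gt0.
have ar : - (d * `|a|) < a * r.
  have : `|a * r| < `|a| * d by rewrite normrM ltr_pM2l.
  by rewrite ltr_norml => /andP[]; lra.
have st2 : s ^+ 2 < t ^+ 2 by rewrite -[s ^+ 2]real_normK ?num_real// ltrXn2r.
have sb := sqr_ge0 (s - b).
by rewrite sqrrB in sb; lra.
Qed.

(** Correcting the value [b = v_i] to [a = x_i] does not bring [v] closer, so [(a - b + r)^2 <= r^2]
    with [r = w_i]. Hence [|a - b| <= 2 |r|], and distinct values are at least [2 d] apart. *)
Lemma ML_value_bad i :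
  i \in supp x :&: supp v -> tnth x i != tnth v i -> i \in bad.
Proof.
rewrite !inE => /andP[xi0 vi0] xv.
have := v_opt (Xset_correct xX vX xi0 vi0).
have [m xim] : exists m, tnth x i = u m by apply: xX.2; rewrite inE.
have [m' vim] : exists m, tnth v i = u m by apply: vX.2; rewrite inE.
rewrite sqdist_update !tnth_mktuple /bad_noise /= xi0.
have := d_sep (m := m) (m' := m'); rewrite -xim -vim => /(_ xv).
move: xv; move: (tnth x i) (tnth w i) (tnth v i) => a r b ab dab opt.
have ab_gt0 : 0 < `|a - b| by rewrite normr_gt0 subr_eq0.
have : `|a - b| * `|a - b| <= `|a - b| * (`|r| *+ 2).
  have abr := ler_norm (- ((a - b) * r)).
  rewrite normrN normrM in abr.
  by rewrite -expr2 real_normK ?num_real//; lra.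
by rewrite ler_pM2l//; lra.
Qed.

(* Missed positions and false alarms are equally many, and [ML_swap_bad] makes
   one of the two sets consist of bad positions only. *)
Lemma ML_missed_le_bad : (#|supp x :\: supp v| <= #|bad|)%N.
Proof.
have cardE : #|supp x :\: supp v| = #|supp v :\: supp x|.
  by rewrite !cardsD finset.setIC xX.1 vX.1.
have [/subset_leq_card//|/subsetPn[i isD ibad]] :=
  boolP (supp x :\: supp v \subset bad).
rewrite cardE; apply/subset_leq_card/fintype.subsetP => j jsD.
by have := ML_swap_bad isD jsD; rewrite (negPf ibad).
Qed.

(** A wrong coordinate is a missed position, a false alarm, or a wrong value on the common support;
    each kind occurs at most [#|bad|] times. [D] bounds the squared error of a coordinate, whether
    one or both of the entries are nonzero. *)
Lemma ML_sqdist_le_bad : sqdist x v <= D * (3 * #|bad|)%:R.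
Proof.
pose wrong := [set i | tnth x i != tnth v i]%SET.
have wrong_le : (#|wrong| <= 3 * #|bad|)%N.
  have sub : wrong \subset (supp x :\: supp v) :|:
      (supp v :\: supp x) :|: bad.
    apply/fintype.subsetP => i; rewrite inE => xv.
    have := @ML_value_bad i; rewrite !inE.
    have [x0|x0] := eqVneq (tnth x i) 0; have [v0|v0] := eqVneq (tnth v i) 0 => //=.
      by move: xv; rewrite x0 v0 eqxx.
    by move=> H; apply/mem_set/H.
  rewrite (leq_trans (subset_leq_card sub))//.
  rewrite (leq_trans (leq_card_setU _ _))// mulSn addnC leq_add//.
  rewrite (leq_trans (leq_card_setU _ _))// mul2n -addnn leq_add//.
    exact: ML_missed_le_bad.
  rewrite (leq_trans _ ML_missed_le_bad)//.
  by rewrite !cardsD finset.setIC xX.1 vX.1.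
have uval (z : N.-tuple R) i : Xset u N k z -> tnth z i != 0 ->
    exists m, tnth z i = u m.
  by move=> zX z0; apply: zX.2; rewrite inE.
have termD i : (tnth x i - tnth v i) ^+ 2 <= D * (i \in wrong)%:R.
  rewrite inE; have [->|xv] := eqVneq; first by rewrite subrr expr0n mulr0.
  rewrite mulr1.
  have [x0|/(uval _ _ xX)[m ->]] := eqVneq (tnth x i) 0;
  have [v0|/(uval _ _ vX)[m' ->]] := eqVneq (tnth v i) 0 => //.
  - by move: xv; rewrite x0 v0 eqxx.
  - by rewrite x0 sub0r sqrrN.
  - by rewrite v0 subr0.
rewrite (le_trans (ler_sum _ (fun i _ => termD i)))//.
have D_ge0 : 0 <= D := le_trans (sqr_ge0 _) (D_ge ord0).
rewrite -mulr_sumr -natr_sum -big_mkcond sum1_card.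
by rewrite ler_wpM2l// ler_nat.
Qed.

End ML_error.

(** * Iterated Gaussian expectation *)

(** The integral of a nonnegative function is a supremum over the simple functions below it, and
    this family grows with the function. *)
Lemma le_integral_ge0 d (T : measurableType d) (R : realType)
    (mu : {measure set T -> \bar R}) (f g : T -> \bar R) :
  (forall x, 0 <= f x)%E -> (forall x, f x <= g x)%E ->
  (\int[mu]_x f x <= \int[mu]_x g x)%E.
Proof.
move=> f0 fg; rewrite !ge0_integralTE//; last first.
  by move=> x; exact: le_trans (fg x).
apply: le_ereal_sup => _ [h hf <-]; exists h => // x.
exact: le_trans (fg x).
Qed.

Lemma gauss_expect_ge0 (R : realType) (s : R) (N : nat)
    (f : N.-tuple R -> \bar R) :
  (forall w, 0 <= f w)%E -> (0 <= gauss_expect s N f)%E.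
Proof. by elim: N f => [|N IH] f f0 //=; apply: integral_ge0 => w _; exact: IH. Qed.

Lemma le_gauss_expect (R : realType) (s : R) (N : nat)
    (f g : N.-tuple R -> \bar R) :
  (forall w, 0 <= f w)%E -> (forall w, f w <= g w)%E ->
  (gauss_expect s N f <= gauss_expect s N g)%E.
Proof.
elim: N f g => [|N IH] f g f0 fg //=.
by apply: le_integral_ge0 => w; [exact: gauss_expect_ge0|exact: IH].
Qed.

(** Induction on [N] with [c] general: once the first coordinate is fixed, its indicator term joins
    the constant of the inner expectation. *)
Lemma gauss_expect_affine (R : realType) (s : R) (N : nat) (c C : R)
    (A : 'I_N -> set R) :
  0 <= c -> 0 <= C -> (forall i, measurable (A i)) ->
  (gauss_expect s N
     (fun w => (c + C * \sum_(i < N) \1_(A i) (tnth w i))%:E) =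
   c%:E + C%:E * \sum_(i < N) normal_prob 0 s (A i))%E.
Proof.
elim: N c A => [|N IH] c A c0 C0 mA.
  by rewrite /= !big_ord0 mulr0 addr0 mule0 adde0.
pose q := (\sum_(i < N) normal_prob 0 s (A (lift ord0 i)))%E.
rewrite /=; transitivity (\int[normal_prob 0 s]_w
    ((c%:E + C%:E * (\1_(A ord0) w)%:E) + C%:E * q))%E.
  apply: eq_integral => w _.
  rewrite -EFinM -EFinD -IH ?addr_ge0 ?mulr_ge0//.
  congr gauss_expect; apply/funext => z.
  rewrite big_ord_recl tnth0 mulrDr addrA; congr (_ + _ * _)%:E.
  by apply: eq_bigr => i _; rewrite tnthS.
have q0 : (0 <= q)%E by exact: sume_ge0.
have m1 : measurable_fun [set: R] (EFin \o (\1_(A ord0) : R -> R)).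
  by apply/measurable_EFinP/measurable_indic.
have mC := measurable_funeM C%:E m1.
have C1 w : (0 <= C%:E * (\1_(A ord0) w)%:E)%E by rewrite mule_ge0.
rewrite ge0_integralD//; first last.
- by move=> w _; exact: mule_ge0.
- exact: emeasurable_funD.
- by move=> w _; rewrite adde_ge0.
rewrite ge0_integralD// ge0_integralZl//.
have pT : normal_prob 0 s [set: R] = 1%E := probability_setT (normal_prob 0 s).
rewrite integral_indic//; last exact: mA.
rewrite setIT !integral_cst// [X in (_ * X + _ + _ * X)%E]pT !mule1.
by rewrite big_ord_recl -addeA -ge0_muleDr//.
Qed.

(** * Gaussian tails *)

Lemma measurable_normr_ge (R : realType) (t : R) :
  measurable [set r : R | t <= `|r|].
Proof.
have -> : [set r : R | t <= `|r|] = setT `&` @Num.norm R R @^-1` `[t, +oo[.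
  by rewrite setTI; apply/seteqP; split => r /=; rewrite in_itv/= andbT.
exact: normr_measurable measurableT _ (measurable_itv _).
Qed.

(* On [t <= |x|] the density at scale [s] is at most a small multiple of the
   density at the larger scale [s / sqrt e]. *)
Lemma normal_tail (R : realType) (s t e : R) :
  0 < s -> 0 <= t -> 0 < e -> e < 1 ->
  (normal_prob 0 s [set r | (t <= `|r|)%R] <=
   ((Num.sqrt e)^-1 * expR (- ((1 - e) * t ^+ 2) / (2 * s ^+ 2)))%:E)%E.
Proof.
move=> s0 t0 e0 e1.
set A := [set r | _].
have mA : measurable A := measurable_normr_ge t.
set K := (X in (_ <= X%:E)%E).
have K0 : 0 <= K by rewrite mulr_ge0 ?invr_ge0 ?sqrtr_ge0 ?expR_ge0.
pose s' := s / Num.sqrt e.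
have se0 : 0 < Num.sqrt e by rewrite sqrtr_gt0.
have s'0 : 0 < s' by rewrite divr_gt0.
have s'2 : s' ^+ 2 = s ^+ 2 / e by rewrite expr_div_n sqr_sqrtr ?ltW.
have pdf_le x : A x -> normal_pdf 0 s x <= K * normal_pdf 0 s' x.
  move=> /= tx; rewrite !normal_pdfE ?gt_eqF//.
  have -> : normal_peak s = (Num.sqrt e)^-1 * normal_peak s'.
    rewrite /normal_peak s'2 -invfM -sqrtrM ?ltW//.
    by congr (Num.sqrt _)^-1; field; rewrite gt_eqF.
  rewrite /K mulrACA; apply: ler_wpM2l.
    by rewrite mulr_ge0 ?invr_ge0 ?sqrtr_ge0 ?normal_peak_ge0.
  rewrite /normal_fun -expRD ler_expR s'2 subr0.
  have x2 : t ^+ 2 <= x ^+ 2 by rewrite -[x ^+ 2]real_normK ?num_real// lerXn2r.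
  have -> : - ((1 - e) * t ^+ 2) / (2 * s ^+ 2) + - x ^+ 2 / (s ^+ 2 / e *+ 2) =
    (- ((1 - e) * t ^+ 2 + e * x ^+ 2)) / (s ^+ 2 *+ 2).
    by field; rewrite !gt_eqF.
  (* The exponents compare because [(1 - e) t^2 + e x^2 <= x^2] when [t <= |x|]. *)
  rewrite ler_pM2r ?invr_gt0 ?mulrn_wgt0 ?exprn_gt0// lerN2.
  have := ler_wpM2l (ltW (_ : 0 < 1 - e)) x2.
  by rewrite subr_gt0 => /(_ e1); lra.
have mpdf s1 : measurable_fun A (EFin \o normal_pdf (0 : R) s1).
  by apply/measurable_EFinP/measurable_funTS; exact: measurable_normal_pdf.
have pdf0 s1 x : (0 <= (normal_pdf 0 s1 x)%:E)%E by rewrite lee_fin normal_pdf_ge0.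
rewrite /normal_prob.
apply: (@le_trans _ _ (\int[lebesgue_measure]_(x in A) (K%:E * (normal_pdf 0 s' x)%:E)))%E.
  apply: ge0_le_integral.
  - exact: mA.
  - by move=> x _; exact: pdf0.
  - exact: mpdf.
  - exact: measurable_funeM (mpdf s').
  - by move=> x Ax; rewrite -EFinM lee_fin pdf_le.
rewrite ge0_integralZl; [|exact: mA|exact: mpdf|by []|by []].
rewrite -[leRHS]mule1 lee_wpmul2l//.
exact: (@probability_le1 _ _ _ (normal_prob 0 s')).
Qed.

(** * Risk at a fixed signal *)

Lemma measurable_bad_noise (R : realType) (d t a : R) :
  measurable (bad_noise d t a).
Proof. exact: measurable_normr_ge. Qed.

Lemma lik_le (R : realType) (N : nat) (s2 : R) (y a b : N.-tuple R) :
  0 < s2 -> lik s2 y a <= lik s2 y b -> sqdist y b <= sqdist y a.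
Proof.
move=> s20; rewrite /lik ler_pM2l ?powR_gt0 ?mulr_gt0 ?pi_gt0//.
by rewrite ler_expR ler_pM2r ?lerN2// invr_gt0 mulr_gt0.
Qed.

Lemma ML_risk_le (R : realType) (M N k : nat) (u : 'I_M.+1 -> R)
    (s d t D e : R) (x : N.-tuple R) (est : N.-tuple R -> N.-tuple R) :
  (forall m, u m != 0) -> 0 < s -> 0 <= d -> 0 <= t -> 0 < e -> e < 1 ->
  (forall m m', u m != u m' -> d *+ 2 <= `|u m - u m'|) ->
  (forall m, t ^+ 2 <= u m ^+ 2 - d *+ 2 * `|u m|) ->
  (forall m, u m ^+ 2 <= D) -> (forall m m', (u m - u m') ^+ 2 <= D) ->
  Xset u N k x -> is_ML u N k (s ^+ 2) est ->
  (gauss_expect s N (fun w => (sqdist x (est (tadd x w)))%:E) <=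
   (D *+ 3 * ((Num.sqrt e)^-1 *
     (k%:R * expR (- ((1 - e) * d ^+ 2) / (2 * s ^+ 2)) +
      N%:R * expR (- ((1 - e) * t ^+ 2) / (2 * s ^+ 2)))))%:E)%E.
Proof.
move=> u0 s0 d0 t0 e0 e1 d_sep t_sep D_ge D_geB xX ML.
have D0 : 0 <= D := le_trans (sqr_ge0 _) (D_ge ord0).
pose A i := bad_noise d t (tnth x i).
have mA i : measurable (A i) := measurable_bad_noise d t (tnth x i).
apply: (@le_trans _ _ (gauss_expect s N
  (fun w => (0 + D *+ 3 * \sum_(i < N) \1_(A i) (tnth w i))%:E))).
  apply: le_gauss_expect => w; rewrite lee_fin.
    by apply: sumr_ge0 => i _; exact: sqr_ge0.
  have [vX v_opt] := ML (tadd x w).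
  have v_le v' : Xset u N k v' ->
      sqdist (tadd x w) (est (tadd x w)) <= sqdist (tadd x w) v'.
    by move=> v'X; apply: lik_le (v_opt _ v'X); rewrite exprn_gt0.
  have := ML_sqdist_le_bad u0 xX vX v_le d_sep t_sep D_ge D_geB.
  move=> /le_trans; apply.
  rewrite add0r natrM mulrA -[D *+ 3]mulr_natr ler_wpM2l ?mulr_ge0//.
  by rewrite -sum1_card natr_sum big_mkcond ler_sum// => i _; rewrite inE indicE; case: ifP.
rewrite gauss_expect_affine ?mulrn_wge0// add0e EFinM lee_wpmul2l//.
  by rewrite lee_fin mulrn_wge0.
set c := (Num.sqrt e)^-1; set a := expR _; set b := expR _.
have c0 : 0 <= c by rewrite invr_ge0 sqrtr_ge0.
(* The off-support bound [b] is charged to every coordinate, support included, so the sum is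
   [k a + N b]. *)
apply: (@le_trans _ _
  (\sum_(i < N) (c * ((i \in supp x)%:R * a + b))%:E)%E).
  apply: lee_sum => i _; rewrite /A /bad_noise inE.
  have [_|_] /= := eqVneq (tnth x i) 0.
    by rewrite mul0r add0r; exact: normal_tail.
  apply: le_trans (normal_tail s0 d0 e0 e1) _.
  by rewrite mul1r lee_fin ler_wpM2l// lerDl expR_ge0.
rewrite sumEFin lee_fin -mulr_sumr ler_wpM2l// big_split/= -mulr_suml.
by rewrite sumr_const card_ord -(mulr_natl b) -natr_sum -big_mkcond sum1_card xX.1.
Qed.

(** * Averaging over the signals *)

Lemma finite_Xset (R : realType) (M : nat) (u : 'I_M -> R) (N k : nat) :
  finite_set (Xset u N k).
Proof.
(* A signal is encoded by its letters, with [None] for a zero coordinate. *)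
pose g (f : {ffun 'I_N -> option 'I_M}) : N.-tuple R :=
  [tuple if f i is Some m then u m else 0 | i < N].
apply: (@sub_finite_set _ _ (g @` setT)); last exact/finite_image/finite_finset.
move=> x [_ xu].
exists [ffun i => [pick m | tnth x i == u m]] => //.
apply: eq_from_tnth => i; rewrite tnth_mktuple ffunE.
case: pickP => [m /eqP//|no]; apply/esym/eqP; apply: contraT => xi.
have [m xm] : exists m, tnth x i = u m by apply: xu; rewrite inE.
by move: (no m); rewrite xm eqxx.
Qed.

Lemma fsum_average_le (R : realType) (T : choiceType) (X : set T)
    (f : T -> \bar R) (B : R) :
  finite_set X -> 0 <= B -> (forall x, X x -> (f x <= B%:E)%E) ->
  ((\sum_(x \in X) f x) * ((\sum_(x \in X) (1 : R))^-1)%:E <= B%:E)%E.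
Proof.
move=> finX B0 fB; set c := \sum_(x \in X) (1 : R).
have c0 : 0 <= c by exact: fsumr_ge0.
have sumB : (\sum_(x \in X) f x <= (B * c)%:E)%E.
  rewrite mulr_fsumr -fsumEFin//.
  by apply: lee_fsum => // x Xx; rewrite mulr1; exact: fB.
apply: le_trans (lee_wpmul2r _ sumB) _; first by rewrite lee_fin invr_ge0.
(* If [X] is empty then [c = 0], whose inverse is [0], and the claim becomes [0 <= B]. *)
rewrite -EFinM lee_fin; have [->|cN0] := eqVneq c 0; first by rewrite mulr0 mul0r.
by rewrite mulfK.
Qed.

(** * Separation of the values and growth of [log(N/k)] *)

Lemma finite_separation (R : realType) (I : finType) (g : I -> R) :
  exists2 d, 0 < d & forall i j, g i != g j -> d *+ 2 <= `|g i - g j|.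
Proof.
(* The default [1] keeps [d] positive when [g] takes a single value. *)
pose d := \big[Num.min/1]_(p : I * I | g p.1 != g p.2) (`|g p.1 - g p.2| / 2).
exists d => [|i j gij].
  by apply: lt_bigmin => // p gp; rewrite divr_gt0// normr_gt0 subr_eq0.
have : d <= `|g i - g j| / 2 by exact: (@bigmin_le_cond _ _ _ _ (i, j)).
by rewrite ler_pdivlMr// mulr_natr.
Qed.

(** Eventually [ln k / ln N] is below [(1 + gamma) / 2], the midpoint of [gamma] and [1], so
    [ln (N / k) = ln N - ln k] is at least [(1 - gamma) / 2 * ln N]. *)
Lemma ln_ratio_cvgy (R : realType) (k N : nat -> nat) (gamma : R) :
  (forall n, (1 <= k n)%N /\ (k n < N n)%N) ->
  (fun n => (N n)%:R : R) @ \oo --> +oo -> gamma < 1 ->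
  (fun n => ln ((k n)%:R) / ln ((N n)%:R)) @ \oo --> gamma ->
  (fun n => ln ((N n)%:R / (k n)%:R) : R) @ \oo --> +oo.
Proof.
move=> kN Ny gamma1 kNgamma.
have c0 : 0 < (1 - gamma) / 2 by rewrite divr_gt0 ?subr_gt0.
apply/cvgryPge => A.
have N_large : \forall n \near \oo, expR (A / ((1 - gamma) / 2)) <= (N n)%:R.
  by move/cvgryPge : Ny; exact.
have ratio_small : \forall n \near \oo,
    ln ((k n)%:R) / ln ((N n)%:R) <= (1 + gamma) / 2.
  by apply: cvgr_le kNgamma _ _; rewrite ltr_pdivlMr// mulr_natr; lra.
near=> n.
have [k1 kltN] := kN n.
have k0 : 0 < (k n)%:R :> R by rewrite ltr0n.
have N0 : 0 < (N n)%:R :> R by rewrite ltr0n (leq_trans _ kltN).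
have lnN0 : 0 < ln (N n)%:R :> R.
  by rewrite ln_gt0// ltr1n (leq_trans _ kltN).
have ratio : ln (k n)%:R <= (1 + gamma) / 2 * ln (N n)%:R.
  by rewrite -ler_pdivrMr//; near: n.
have lnN : A / ((1 - gamma) / 2) <= ln (N n)%:R.
  by rewrite -ler_expR lnK ?posrE//; near: n.
rewrite ln_div ?posrE//; move: lnN; rewrite ler_pdivrMr//; lra.
Unshelve. all: by end_near.
Qed.

Lemma expR_decay (R : realType) (L : nat -> R) (c : R) :
  0 < c -> L @ \oo --> +oo -> (fun n => expR (- (c * L n))) @ \oo --> 0.
Proof.
move=> c0 Ly.
have cLy : (fun n => c * L n) @ \oo --> +oo.
  apply/cvgryPge => A; move/cvgryPge : Ly => /(_ (A / c)).
  by apply: filterS => n; rewrite ler_pdivrMr// mulrC.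
exact: cvg_comp cLy (@cvgr_expR R).
Qed.

(** * Choice of the noise thresholds *)

Lemma umin_gt0 (R : realType) (M : nat) (u : 'I_M.+1 -> R) :
  (forall m, u m != 0) -> 0 < umin u.
Proof. by move=> u0; apply: lt_bigmin => [|m _]; rewrite normr_gt0. Qed.

Lemma umin_le (R : realType) (M : nat) (u : 'I_M.+1 -> R) m : umin u <= `|u m|.
Proof. exact: bigmin_le. Qed.

(* [d] bounds the noise tolerated on the support of the signal and [t] the noise
   tolerated off the support: [t ^+ 2 = umin ^+ 2 - 2 d umin] still exceeds
   [2 sigma2] when [d] is small. *)
Lemma thresholds (R : realType) (M : nat) (u : 'I_M.+1 -> R) (sigma2 : R) :
  (forall m, u m != 0) -> sigma2 < umin u ^+ 2 / 2 ->
  exists d t, [/\ 0 < d, 0 <= t, 2 * sigma2 < t ^+ 2,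
    forall m m', u m != u m' -> d *+ 2 <= `|u m - u m'| &
    forall m, t ^+ 2 <= u m ^+ 2 - d *+ 2 * `|u m|].
Proof.
move=> u0 su; have b0 := umin_gt0 u0; set b := umin u in su b0 *.
have [d0 d0_gt0 sep] := finite_separation u.
(* With [d <= h], the bound [h <= b / 4] keeps [b^2 - 2 d b] positive under the root, and
   [4 h b <= b^2 - 2 sigma2] makes [2 d b] at most half the gap between [b^2] and [2 sigma2]. *)
pose h := Num.min b ((b ^+ 2 - 2 * sigma2) / b) / 4.
have gap : 0 < b ^+ 2 - 2 * sigma2 by lra.
have h0 : 0 < h by rewrite divr_gt0// lt_min b0 divr_gt0.
pose d := Num.min d0 h.
have hb : h <= b / 4 by rewrite ler_pM2r// ge_min lexx.
have hgap : 4 * h * b <= b ^+ 2 - 2 * sigma2.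
  by rewrite -ler_pdivlMr// /h mulrC divfK// ge_min lexx orbT.
have dh : d <= h by rewrite ge_min lexx orbT.
have db : d * b <= h * b by rewrite ler_pM2r.
have hb2 : h * b <= b / 4 * b by rewrite ler_pM2r.
have d_gt0 : 0 < d by rewrite lt_min d0_gt0.
have t2 : Num.sqrt (b ^+ 2 - d *+ 2 * b) ^+ 2 = b ^+ 2 - d *+ 2 * b.
  rewrite sqr_sqrtr//; rewrite expr2 mulr2n; nra.
exists d, (Num.sqrt (b ^+ 2 - d *+ 2 * b)); split => //.
- by rewrite t2 mulr2n; nra.
- move=> m m' /sep; apply: le_trans; rewrite lerMn2r//.
  by rewrite ge_min lexx.
- move=> m; rewrite t2 -[u m ^+ 2]real_normK ?num_real//.
  have := umin_le u m; rewrite -/b; move: `|u m| => a ba.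
  (* This product is the increment of [a^2 - 2 d a] from [b] to [a], so [u_min] is the worst
     case. *)
  have : 0 <= (a - b) * (a + b - d *+ 2).
    by rewrite mulr_ge0 ?subr_ge0// mulr2n; lra.
  by rewrite !expr2 mulr2n; lra.
Qed.

(** * Assembly of the limit *)

Unset Implicit Arguments.

Theorem theorem1 (R : realType) (M : nat) (u : 'I_M.+1 -> R) (sigma2 : R)
  (k N : nat -> nat) (gamma : R)
  (est : forall n, (N n).-tuple R -> (N n).-tuple R) :
  injective u -> (forall m, u m != 0) -> 0 < sigma2 ->
  sigma2 < umin u ^+ 2 / 2 ->
  (forall n, (1 <= k n)%N /\ (k n < N n)%N) ->
  (fun n => (k n)%:R : R) @ \oo --> +oo ->
  (fun n => (N n)%:R : R) @ \oo --> +oo ->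
  0 <= gamma -> gamma < 1 ->
  (fun n => ln ((k n)%:R) / ln ((N n)%:R)) @ \oo --> gamma ->
  (forall n, measurable_fun [set: (N n).-tuple R] (est n)) ->
  (forall n, is_ML u (N n) (k n) (sigmaNk sigma2 (N n) (k n)) (est n)) ->
  (fun n => (((k n)%:R^-1)%:E *
     (* E over x uniform on X_k^N(U) and omega ~ N(0, sigma_{N/k}^2 I_N) *)
     ((\big[+%E/0%E]_(x \in Xset u (N n) (k n))
        gauss_expect (Num.sqrt (sigmaNk sigma2 (N n) (k n))) (N n)
          (fun w => (sqdist x (est n (tadd x w)))%:E))
      * ((\sum_(x \in Xset u (N n) (k n)) (1 : R))^-1)%:E))%E) @ \oo --> 0%E.
Proof.
move=> _ u0 sigma0 su kN _ Ny _ gamma1 kNgamma _ ML.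
have [d [t [d0 t0 sigma_t d_sep t_sep]]] := thresholds u0 su.
have t2_gt0 : 0 < t ^+ 2 by lra.
(* This [e] makes [(1 - e) t^2] the midpoint of [t^2] and [2 sigma2], so the off-support exponent
   stays above [1]. *)
pose e := (t ^+ 2 - 2 * sigma2) / (2 * t ^+ 2).
have e0 : 0 < e by apply: divr_gt0; lra.
have e1 : e < 1 by rewrite ltr_pdivrMr; lra.
have et2 : (1 - e) * t ^+ 2 = (t ^+ 2 + 2 * sigma2) / 2.
  by rewrite /e; field; rewrite -sqrf_eq0 gt_eqF.
pose D := \sum_m `|u m| ^+ 2 + \sum_m \sum_m' (u m - u m') ^+ 2.
have sum_ge (F : 'I_M.+1 -> R) i : (forall m, 0 <= F m) -> F i <= \sum_m F m.
  by move=> F0; rewrite (bigD1 i)//= lerDl sumr_ge0.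
have D_ge m : u m ^+ 2 <= D.
  rewrite -[u m ^+ 2]real_normK ?num_real//.
  rewrite (le_trans (sum_ge (fun m => `|u m| ^+ 2) m _))//.
  by rewrite lerDl !sumr_ge0// => i _; rewrite sumr_ge0// => j _; exact: sqr_ge0.
have D_geB m m' : (u m - u m') ^+ 2 <= D.
  rewrite (le_trans (sum_ge (fun m' => (u m - u m') ^+ 2) m' _))//.
    by move=> ?; exact: sqr_ge0.
  rewrite (le_trans (sum_ge (fun m => \sum_m' (u m - u m') ^+ 2) m _))//.
    by move=> i; rewrite sumr_ge0// => j _; exact: sqr_ge0.
  by rewrite lerDr sumr_ge0.
have D0 : 0 <= D := le_trans (sqr_ge0 _) (D_ge ord0).
pose L n : R := ln ((N n)%:R / (k n)%:R).
have k_gt0 n : 0 < (k n)%:R :> R by rewrite ltr0n; case: (kN n).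
have N_gt0 n : 0 < (N n)%:R :> R.
  by rewrite ltr0n; case: (kN n) => _; exact: leq_ltn_trans.
have L_gt0 n : 0 < L n.
  by rewrite ln_gt0// ltr_pdivlMr// mul1r ltr_nat; case: (kN n).
pose cA := (1 - e) * d ^+ 2 / (2 * sigma2).
(* The [- 1] accounts for the factor [N / k = expR L] multiplying the off-support tail. *)
pose cB := (1 - e) * t ^+ 2 / (2 * sigma2) - 1.
pose K := D *+ 3 * (Num.sqrt e)^-1.
have K0 : 0 <= K by rewrite mulr_ge0 ?mulrn_wge0 ?invr_ge0 ?sqrtr_ge0.
pose bound n := K * (expR (- (cA * L n)) + expR (- (cB * L n))).
have Ly := ln_ratio_cvgy kN Ny gamma1 kNgamma.
have bound_cvg : (EFin \o bound) @ \oo --> 0%E.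
  have -> : 0%E = (K * (0 + 0))%:E :> \bar R by rewrite addr0 mulr0.
  apply: cvg_EFin; first exact: nearW.
  apply: cvgMr; apply: cvgD.
    by apply: expR_decay Ly; rewrite /cA divr_gt0 ?mulr_gt0 ?exprn_gt0 ?subr_gt0.
  apply: expR_decay Ly.
  by rewrite /cB subr_gt0 ltr_pdivlMr ?mulr_gt0// et2; lra.
apply: (squeeze_cvge _ _ bound_cvg); last first.
  exact: cvg_cst.
apply: nearW => n; apply/andP; split.
  rewrite mule_ge0 ?lee_fin ?invr_ge0// mule_ge0//.
    apply: fsume_ge0 => x _; apply: gauss_expect_ge0 => w.
    by rewrite lee_fin sumr_ge0// => i _; exact: sqr_ge0.
  by rewrite lee_fin invr_ge0 fsumr_ge0.
set s2 := sigmaNk sigma2 (N n) (k n).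
have s2E : s2 = sigma2 / L n by [].
have s2_gt0 : 0 < s2 by rewrite s2E divr_gt0.
set s := Num.sqrt s2.
have s_gt0 : 0 < s by rewrite sqrtr_gt0.
have sK : s ^+ 2 = s2 by rewrite sqr_sqrtr// ltW.
have ML' := ML n; rewrite -/s2 -sK in ML'.
have risk x (xX : Xset u (N n) (k n) x) :=
  ML_risk_le u0 s_gt0 (ltW d0) t0 e0 e1 d_sep t_sep D_ge D_geB xX ML'.
(* As [s^2 = sigma2 / L], both tail bounds become exponentials linear in [L n]. *)
have exponent c : - ((1 - e) * c) / (2 * s ^+ 2) =
    - ((1 - e) * c / (2 * sigma2) * L n).
  by rewrite sK s2E; field; rewrite !gt_eqF.
have NE : (N n)%:R = (k n)%:R * expR (L n).
  by rewrite lnK ?posrE ?divr_gt0// mulrC divfK// gt_eqF.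
have boundE : bound n = (k n)%:R^-1 * (D *+ 3 * ((Num.sqrt e)^-1 *
    ((k n)%:R * expR (- ((1 - e) * d ^+ 2) / (2 * s ^+ 2)) +
     (N n)%:R * expR (- ((1 - e) * t ^+ 2) / (2 * s ^+ 2))))).
  rewrite !exponent NE -[_ * expR (L n) * _]mulrA -expRD.
  have -> : L n - (1 - e) * t ^+ 2 / (2 * sigma2) * L n = - (cB * L n).
    by rewrite /cB; ring.
  rewrite -mulrDr [X in _ * X]mulrA -/K [in RHS]mulrCA.
  by rewrite [X in _ * X]mulrA mulVf ?mul1r// gt_eqF.
rewrite /= boundE EFinM lee_wpmul2l ?lee_fin ?invr_ge0//.
apply: fsum_average_le (finite_Xset _ _ _) _ risk.
by rewrite mulr_ge0 ?mulrn_wge0// mulr_ge0 ?invr_ge0 ?sqrtr_ge0.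
Qed.
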